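(* Consider the nonlinear control-affine system $\dot{\mathbf{x}}=\mathbf{f}(\mathbf{x})+\mathbf{g}(\mathbf{x})\mathbf{u}$, $\mathbf{y}=\mathbf{h}(\mathbf{x})$ with state $\mathbf{x}\in\mathbb{R}^n$. Let its input-normal/output-diagonal transformation $\boldsymbol{\Phi}$ and its scaling transformation $\boldsymbol{\varphi}$ (defined in the context) be expanded in Kronecker polynomial form as $$\mathbf{x}=\boldsymbol{\Phi}(\mathbf{z})=\mathbf{T}_1\mathbf{z}+\mathbf{T}_2\mathbf{z}^{\otimes 2}+\mathbf{T}_3\mathbf{z}^{\otimes 3}+\cdots,\qquad \mathbf{z}=\boldsymbol{\varphi}(\bar{\mathbf{z}})=\mathbf{A}_1\bar{\mathbf{z}}+\mathbf{A}_2\bar{\mathbf{z}}^{\otimes 2}+\mathbf{A}_3\bar{\mathbf{z}}^{\otimes 3}+\cdots,$$ with coefficients $\mathbf{T}_k,\mathbf{A}_k\in\mathbb{R}^{n\times n^k}$ for $k=1,2,\dots$. Then the balancing transformation is locally approximated as $$\mathbf{x}=\bar{\boldsymbol{\Phi}}(\bar{\mathbf{z}})=\boldsymbol{\Phi}(\boldsymbol{\varphi}(\bar{\mathbf{z}}))=\bar{\mathbf{T}}_1\bar{\mathbf{z}}+\bar{\mathbf{T}}_2\bar{\mathbf{z}}^{\otimes 2}+\bar{\mathbf{T}}_3\bar{\mathbf{z}}^{\otimes 3}+\cdots,$$ where, for every $i\ge 1$, $$\bar{\mathbf{T}}_i=\sum_{j=1}^{i}\mathbf{T}_j\,\mathcal{A}_{j,i},$$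 and $\mathcal{A}_{j,i}\in\mathbb{R}^{n^j\times n^i}$ denotes the sum of all unique tensor products of the $\mathbf{A}_k$ with $j$ factors and $n^i$ columns.
   Context: Kronecker notation. $\otimes$ is the Kronecker product, and $\mathbf{x}^{\otimes k}=\mathbf{x}\otimes\cdots\otimes\mathbf{x}$ ($k$ factors) is in $\mathbb{R}^{n^k}$ for $\mathbf{x}\in\mathbb{R}^n$. Given matrices $\mathbf{A}_k\in\mathbb{R}^{n\times m^k}$ ($k\ge1$), the sum of all unique tensor products with $p$ factors and $m^q$ columns is $$\mathcal{A}_{p,q}=\sum_{i_1+\cdots+i_p=q,\; i_1,\dots,i_p\ge 1}\mathbf{A}_{i_1}\otimes\cdots\otimes\mathbf{A}_{i_p}\in\mathbb{R}^{n^p\times m^q},$$ the sum being over ordered $p$-tuples of positive integers. Series convention. All expansions are power series about the origin, with series taken to infinity. ''Locally approximated as'' with a series means that for each $k$ the homogeneous degree-$k$ part of the Taylor expansion at the origin of the function is the $k$-th term of the series (truncating at a finite degree gives an approximation near the origin). Setting. The system $\dot{\mathbf{x}}=\mathbf{f}(\mathbf{x})+\mathbf{g}(\mathbf{x})\mathbf{u}$, $\mathbf{y}=\mathbf{h}(\mathbf{x})$ has $\mathbf{x}\in\mathbb{R}^n$, $\mathbf{u}\in\mathbb{R}^m$, $\mathbf{y}\in\mathbb{R}^p$, and its Jacobian linearization at the origin is minimal, asymptotically stable, and has distinct Hankel singular values. Its energy functions, assumed to exist, be finite, and be smooth near the origin, are $$\mathcal{E}_c(\mathbf{x}_0)=\min_{\mathbf{u}\in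 L_2(-\infty,0),\ \mathbf{x}(-\infty)=0,\ \mathbf{x}(0)=\mathbf{x}_0}\tfrac12\int_{-\infty}^0\|\mathbf{u}(t)\|^2dt,\qquad \mathcal{E}_o(\mathbf{x}_0)=\tfrac12\int_0^\infty\|\mathbf{y}(t)\|^2dt\ \text{ with }\mathbf{x}(0)=\mathbf{x}_0,\ \mathbf{u}\equiv0.$$ An input-normal/output-diagonal transformation is a smooth coordinate transformation $\mathbf{x}=\boldsymbol{\Phi}(\mathbf{z})$ near the origin, $\boldsymbol{\Phi}(0)=0$, with $$\mathcal{E}_c(\boldsymbol{\Phi}(\mathbf{z}))=\tfrac12\sum_{i=1}^n z_i^2,\qquad \mathcal{E}_o(\boldsymbol{\Phi}(\mathbf{z}))=\tfrac12\sum_{i=1}^n z_i^2\sigma_i^2(z_i);$$ the functions $\sigma_i$ are the singular value functions, with $\sigma_i(0)>0$. The scaling transformation $\mathbf{z}=\boldsymbol{\varphi}(\bar{\mathbf{z}})$ is the local inverse of the componentwise map $\bar z_i=z_i\sqrt{\sigma_i(z_i)}$; equivalently $z_i=\varphi_i(\bar{\mathbf z})=\bar z_i/\sqrt{\bar\sigma_i(\bar z_i)}$ where $\bar\sigma_i(\bar z_i)=\sigma_i(z_i)$. The balancing transformation is the composition $\bar{\boldsymbol{\Phi}}=\boldsymbol{\Phi}\circ\boldsymbol{\varphi}$. *)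

(* Defs.v *)
From HB Require Import structures.
From mathcomp Require Import all_boot all_order all_algebra.
From mathcomp Require Import mxtens.
From mathcomp Require Import all_classical all_reals all_analysis.
Import Order.TTheory GRing.Theory Num.Theory.
Import numFieldNormedType.Exports.

Set Implicit Arguments.
Unset Strict Implicit.
Unset Printing Implicit Defensive.

Local Open Scope classical_set_scope.
Local Open Scope ring_scope.

Section Kronecker.
Variable R : realType.

(* [x ^t k] has the type ['M_(n ^ k, 1 ^ k)]. *)
Definition kron_pow n (x : 'cV[R]_n) (k : nat) : 'cV[R]_(n ^ k) :=
  castmx (erefl _, exp1n k) (x ^t k).

Fixpoint kron_prod n m (A : forall k, 'M[R]_(n, m ^ k)) (s : seq nat) :
    'M[R]_(n ^ size s, m ^ sumn s) :=
  match s with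
  | [::] => 1%:M
  | i :: s' => castmx (esym (expnS n (size s')), esym (expnD m i (sumn s')))
                 (A i *t kron_prod A s')
  end.

(* Every tuple of positive integers of sum q has its entries in ['I_q.+1].
   [conform_mx 0] only transports along [size i = p] and [sumn i = q], which
   hold for each tuple of the index set: its default value 0 is never used. *)
Definition kron_sum n m (A : forall k, 'M[R]_(n, m ^ k)) (p q : nat) :
    'M[R]_(n ^ p, m ^ q) :=
  \sum_(i : p.-tuple 'I_q.+1 |
        all (fun k : 'I_q.+1 => 0 < k)%N i && (sumn (map val i) == q))
    conform_mx 0 (kron_prod A (map val i)).

End Kronecker.

Section Expansion.
Variable R : realType.

Definition iter_derive (V W : normedModType R) (F : V -> W) (vs : seq V) :
  V -> W := foldr (fun v G => 'D_v G) F vs.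

Definition smooth_near0 (V W : normedModType R) (F : V -> W) :=
  exists2 U : set V, open_nbhs 0 U &
    forall vs x, U x -> differentiable (iter_derive F vs) x.

(* D^k F(0)(x, ..., x) / k! *)
Definition taylor_part (V W : normedModType R) (F : V -> W) (k : nat) (x : V)
  : W := (k`!%:R)^-1 *: iter_derive F (nseq k x) 0.

(* Smoothness makes the Taylor parts meaningful, as ['D_v] is total; [F 0] is
   the part of degree 0, and the coefficient [T 0] plays no role. *)
Definition has_kron_expansion n m (F : 'cV[R]_m -> 'cV[R]_n)
    (T : forall k, 'M[R]_(n, m ^ k)) :=
  [/\ smooth_near0 F, F 0 = 0 &
      forall k x, (0 < k)%N -> taylor_part F k x = T k *m kron_pow x k].

Definition local_inverse (V W : normedModType R) (F : V -> W) (G : W -> V) :=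
  exists (U : set V) (U' : set W),
    [/\ nbhs 0 U, nbhs 0 U',
        forall z, U z -> U' (F z) /\ G (F z) = z
      & forall x, U' x -> U (G x) /\ F (G x) = x].

End Expansion.

Section LinearSystem.
Variable R : realType.
Notation mu := (@lebesgue_measure R).

(* The norm of the library on matrices is the maximum norm. *)
Definition sqnorm n (v : 'cV[R]_n) : R := \sum_i v i 0 ^+ 2.

(* [x] is locally absolutely continuous on [J] with derivative [v] a.e. *)
Definition has_velocity n (J : set R) (x v : R -> 'cV[R]_n) :=
  forall s t, J s -> J t -> s <= t -> forall i,
    mu.-integrable `[s, t] (fun r => (v r i 0)%:E) /\
    x t i 0 = x s i 0 + \int[mu]_(r in `[s, t]) v r i 0.

(* Lyapunov stability and local attractivity of the origin of x' = A x. *)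
Definition asymptotically_stable n (A : 'M[R]_n) :=
  let solution (x : R -> 'cV[R]_n) :=
    has_velocity `[0%R, +oo[ x (fun t => A *m x t) in
  (forall e : R, 0 < e -> exists2 d : R, 0 < d & forall x, solution x ->
     `|x 0| < d -> forall t, 0 <= t -> `|x t| < e) /\
  (exists2 d : R, 0 < d & forall x, solution x ->
     `|x 0| < d -> x t @[t --> +oo] --> (0 : 'cV[R]_n)).

Definition same_transfer_function m p n (A : 'M[R]_n) (B : 'M[R]_(n, m))
    (C : 'M[R]_(p, n)) n' (A' : 'M[R]_n') (B' : 'M[R]_(n', m))
    (C' : 'M[R]_(p, n')) :=
  forall s : R, s%:M - A \in unitmx -> s%:M - A' \in unitmx ->
    C *m invmx (s%:M - A) *m B = C' *m invmx (s%:M - A') *m B'.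

Definition minimal m p n (A : 'M[R]_n) (B : 'M[R]_(n, m)) (C : 'M[R]_(p, n)) :=
  forall n' (A' : 'M[R]_n') (B' : 'M[R]_(n', m)) (C' : 'M[R]_(p, n')),
    same_transfer_function A B C A' B' C' -> (n <= n')%N.

Definition expm n (A : 'M[R]_n) : 'M[R]_n :=
  limn (series (fun k => (k`!%:R)^-1 *: A ^+ k)).

Definition ctrl_gramian m n (A : 'M[R]_n) (B : 'M[R]_(n, m)) : 'M[R]_n :=
  \matrix_(i, j) (\int[mu]_(t in `[0%R, +oo[)
    ((expm (t *: A) *m B *m B^T *m expm (t *: A^T)) i j)).

Definition obs_gramian p n (A : 'M[R]_n) (C : 'M[R]_(p, n)) : 'M[R]_n :=
  \matrix_(i, j) (\int[mu]_(t in `[0%R, +oo[)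
    ((expm (t *: A^T) *m C^T *m C *m expm (t *: A)) i j)).

Definition hankel_singular_values m p n (A : 'M[R]_n) (B : 'M[R]_(n, m))
    (C : 'M[R]_(p, n)) (s : 'I_n -> R) :=
  (forall i, 0 <= s i) /\
  char_poly (ctrl_gramian A B *m obs_gramian A C)
    = \prod_i ('X - (s i ^+ 2)%:P).

Definition jacobian0 n p (F : 'cV[R]_n -> 'cV[R]_p) : 'M[R]_(p, n) :=
  \matrix_(i, j) ('D_(delta_mx j 0) F 0) i 0.

End LinearSystem.

Section NonlinearSystem.
Variables (R : realType) (n m p : nat).
Variables (f : 'cV[R]_n -> 'cV[R]_n) (g : 'cV[R]_n -> 'M[R]_(n, m)).
Variable h : 'cV[R]_n -> 'cV[R]_p.
Notation mu := (@lebesgue_measure R).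

Definition trajectory (J : set R) (u : R -> 'cV[R]_m) (x : R -> 'cV[R]_n) :=
  has_velocity J x (fun t => f (x t) + g (x t) *m u t).

(* \int |u|^2, in the extended reals *)
Definition sqnormL2 k (J : set R) (u : R -> 'cV[R]_k) : \bar R :=
  (\int[mu]_(t in J) (sqnorm (u t))%:E)%E.

Definition in_L2 k (J : set R) (u : R -> 'cV[R]_k) :=
  (forall i, measurable_fun J (fun t => u t i 0)) /\ (sqnormL2 J u < +oo)%E.

Definition input_energies (x0 : 'cV[R]_n) : set (\bar R) :=
  [set c | exists (u : R -> 'cV[R]_m) (x : R -> 'cV[R]_n),
     [/\ in_L2 `]-oo, 0%R[ u, trajectory `]-oo, 0%R] u x,
         x t @[t --> -oo] --> (0 : 'cV[R]_n), x 0 = x0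
       & c = ((2^-1)%:E * sqnormL2 `]-oo, 0%R[ u)%E]].

Definition output_energies (x0 : 'cV[R]_n) : set (\bar R) :=
  [set c | exists x : R -> 'cV[R]_n,
     [/\ trajectory `[0%R, +oo[ (fun=> 0) x, x 0 = x0
       & c = ((2^-1)%:E * sqnormL2 `[0%R, +oo[ (h \o x))%E]].

Definition controllability_energy (Ec : 'cV[R]_n -> R) :=
  smooth_near0 Ec /\
  \forall x0 \near (0 : 'cV[R]_n),
    input_energies x0 (Ec x0)%:E /\ lbound (input_energies x0) (Ec x0)%:E.

(* The trajectory issued from x0 need not be unique for an arbitrary [f]; the
   equality below says that one exists and that its energy only depends on x0. *)
Definition observability_energy (Eo : 'cV[R]_n -> R) :=
  smooth_near0 Eo /\
  \forall x0 \near (0 : 'cV[R]_n), output_energies x0 = [set (Eo x0)%:E].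

Definition admissible_linearization :=
  let A := jacobian0 f in let B := g 0 in let C := jacobian0 h in
  [/\ differentiable f 0 /\ differentiable h 0,
      minimal A B C,
      asymptotically_stable A
    & exists2 s, hankel_singular_values A B C s & injective s].

End NonlinearSystem.

Section Balancing.
Variables (R : realType) (n : nat).

Definition coordinate_change (Phi : 'cV[R]_n -> 'cV[R]_n) :=
  [/\ Phi 0 = 0, smooth_near0 Phi &
      exists2 Psi, smooth_near0 Psi & local_inverse Phi Psi].

Definition input_normal_output_diagonal (Ec Eo : 'cV[R]_n -> R)
    (Phi : 'cV[R]_n -> 'cV[R]_n) (sigma : 'I_n -> R -> R) :=
  [/\ coordinate_change Phi,
      forall i, 0 < sigma i 0,
      \forall z \near (0 : 'cV[R]_n),
        Ec (Phi z) = 2^-1 * \sum_i z i 0 ^+ 2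
    & \forall z \near (0 : 'cV[R]_n),
        Eo (Phi z) = 2^-1 * \sum_i z i 0 ^+ 2 * sigma i (z i 0) ^+ 2].

Definition scaling_transformation (sigma : 'I_n -> R -> R)
    (phi : 'cV[R]_n -> 'cV[R]_n) :=
  local_inverse
    (fun z : 'cV[R]_n => \col_i (z i 0 * Num.sqrt (sigma i (z i 0)))) phi.

End Balancing.

(* Main.v *)
Require Import Defs.
From HB Require Import structures.
From mathcomp Require Import all_boot all_order all_algebra.
From mathcomp Require Import mxtens.
From mathcomp Require Import all_classical all_reals all_analysis.
Import Order.TTheory GRing.Theory Num.Theory.
Import numFieldNormedType.Exports.

Local Open Scope classical_set_scope.
Local Open Scope ring_scope.
Set Implicit Arguments.
Unset Strict Implicit.
Unset Printing Implicit Defensive.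

(** Fix a direction [x] and restrict everything to the curve
    [t |-> Phi (phi (t *: x))], [t > 0].  Each entry of this curve is a real
    function of one real variable, and two polynomials that both approximate
    such a function up to [O(t ^+ k.+1)] as [t] tends to 0 have the same
    coefficient of degree [k] ([has_jet_unique]).  Two approximations are
    available:

    - Taylor's formula along the line of direction [x] for the composite map,
      whose coefficient of degree [k] is the [k]-th Taylor part at [x]
      ([has_jet_line]); the composite is smooth because the chain rule expresses
      its derivatives as sums of products of derivatives of the two maps
      ([n_differentiable_comp]);
    - Taylor's formula in several variables for [Phi] ([taylor_column]), whose
      remainder at [y = phi (t *: x)] is [O(`|y| ^+ k.+1)], hence
      [O(t ^+ k.+1)].  What remains is a polynomial in the entries of
      [phi (t *: x)], each of which is approximated by its own Taylor polynomial
      in [t].  Approximations are compatible with sums and products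
      ([has_jet_sum], [has_jet_prod]), so one may substitute.

    The coefficient of degree [k] after the substitution is computed entrywise.
    A row index of the [p]-th Kronecker power is a word of [p] indices, its
    digits in base [n], and the entry of [y^{(x) p}] at this index is the product
    of the entries of [y] along the word ([kron_powE]).  The coefficient of
    degree [q] of a product of [p] power series without constant term is the sum,
    over the compositions [i_1 + ... + i_p = q] into positive integers, of the
    products of the coefficients of degrees [i_1], ..., [i_p]: this is the entry
    of the sum of all tensor products with [p] factors and [n ^ q] columns
    ([kron_sumE]).

    The two computations meet in [has_kron_expansion_comp]. *)

(** * Finite differentiability and the chain rule *)

Section FiniteDifferentiability.
Variables (R : realType) (V : normedModType R).

(** The difference of the two functions vanishes around [x], so its differential
    is 0. *)
Lemma near_eq_differentiable (W : normedModType R) (f g : V -> W) x :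
  (\near x, f x = g x) -> differentiable f x -> differentiable g x.
Proof.
move=> fg df.
have fgx := nbhs_singleton fg.
move: fg; rewrite (near_shift 0 x) subr0 => fg.
have key : (g - f) \o shift x = cst ((g - f) x) + (\0 : V -> W) +o_ 0 id.
  apply/eqaddoP => e e0; near=> h.
  have fgh : f (h + x) = g (h + x) by near: h.
  by rewrite !fctE /= fgh fgx !subrr addr0 subrr normr0 mulr_ge0 // ltW.
have cont0 : continuous (\0 : V -> W) by move=> y; exact: cvg_cst.
have dh : differentiable (g - f) x.
  by apply/diff_locallyP; rewrite (diff_unique cont0 key); split.
have -> : g = f + (g - f) by rewrite addrC subrK.
exact: differentiableD.
Unshelve. all: by end_near.
Qed.

Variable U : set V.
Hypothesis openU : open U.

Lemma open_near (P : V -> Prop) x :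
  (forall y, U y -> P y) -> U x -> \near x, P x.
Proof. by move=> UP Ux; apply: filterS UP _; exact: open_nbhs_nbhs. Qed.

(** The functions that can be differentiated [k.+1] times on [U].  Bounding the
    number of derivatives is what makes inductions on [k] possible: the
    derivative of a product or of a composite involves functions that are only
    known to be differentiable one time less. *)
Fixpoint n_differentiable {W : normedModType R} k (f : V -> W) : Prop :=
  (forall x, U x -> differentiable f x) /\
  if k is k'.+1 then forall v, n_differentiable k' ('D_v f) else True.

Lemma n_differentiableW (W : normedModType R) k (f : V -> W) :
  n_differentiable k f -> forall x, U x -> differentiable f x.
Proof. by case: k => [|k] []. Qed.

Lemma n_differentiable_pred (W : normedModType R) k (f : V -> W) :
  n_differentiable k.+1 f -> n_differentiable k f.
Proof.
elim: k f => [|k IH] f [df Df]; first by split.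
by split => // v; apply/IH/Df.
Qed.

Lemma iter_derive_rcons (W : normedModType R) (f : V -> W) vs v :
  iter_derive f (rcons vs v) = iter_derive ('D_v f) vs.
Proof. by rewrite /iter_derive foldr_rcons. Qed.

(** [iter_derive] puts the new derivative outside and [n_differentiable] puts it
    inside, so that the list of directions is read from its end. *)
Lemma n_differentiableP (W : normedModType R) k (f : V -> W) :
  n_differentiable k f <->
  forall vs x, (size vs <= k)%N -> U x -> differentiable (iter_derive f vs) x.
Proof.
elim: k f => [|k IH] f.
  split=> [[df _] [|v vs] x //= _|df]; first exact: df.
  by split=> // x Ux; exact: (df [::]).
split=> [[df Df] vs x|H].
  case/lastP: vs => [|vs v] sz Ux; first exact: df.
  rewrite size_rcons ltnS in sz.
  by rewrite iter_derive_rcons; exact: (proj1 (IH _) (Df v)).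
split=> [x Ux|v]; first exact: (H [::]).
apply/IH => vs x sz Ux.
by have := H (rcons vs v) x; rewrite iter_derive_rcons size_rcons; apply.
Qed.

Lemma eq_derive_on (W : normedModType R) (f g : V -> W) v :
  (forall x, U x -> f x = g x) -> forall x, U x -> 'D_v f x = 'D_v g x.
Proof. by move=> fg x Ux; apply: near_eq_derive; exact: open_near. Qed.

Lemma eq_iter_derive_on (W : normedModType R) (f g : V -> W) vs :
  (forall x, U x -> f x = g x) ->
  forall x, U x -> iter_derive f vs x = iter_derive g vs x.
Proof. by move=> fg; elim: vs => //= v vs IH x Ux; exact: eq_derive_on. Qed.

Lemma eq_n_differentiable (W : normedModType R) k (f g : V -> W) :
  (forall x, U x -> f x = g x) -> n_differentiable k f -> n_differentiable k g.
Proof.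
move=> fg df; have dg x : U x -> differentiable g x.
  move=> Ux; apply: near_eq_differentiable (n_differentiableW df Ux).
  exact: open_near.
elim: k f g fg df dg => [|k IH] f g fg [df Df] dg; split=> // v.
apply: (IH ('D_v f) _ _ (Df v)) => [x Ux|x Ux]; first exact: eq_derive_on.
apply: near_eq_differentiable (n_differentiableW (Df v) Ux).
by apply: open_near Ux; exact: eq_derive_on.
Qed.

Lemma n_differentiable_cst (W : normedModType R) k (a : W) :
  n_differentiable k (cst a : V -> W).
Proof.
elim: k a => [|k IH] a; split=> // v.
apply: (@eq_n_differentiable _ _ (cst 0)) => // x _.
by rewrite derive_cst.
Qed.

Lemma n_differentiableD (W : normedModType R) k (f g : V -> W) :
  n_differentiable k f -> n_differentiable k g -> n_differentiable k (f + g).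
Proof.
elim: k f g => [|k IH] f g df dg.
  split=> // x Ux; apply: differentiableD.
    exact: (n_differentiableW df).
  exact: (n_differentiableW dg).
split=> [x Ux|v].
  exact: differentiableD (n_differentiableW df Ux) (n_differentiableW dg Ux).
have [[df0 Df] [dg0 Dg]] := (df, dg).
apply: (@eq_n_differentiable _ _ ('D_v f + 'D_v g));
  last exact: (IH _ _ (Df v) (Dg v)).
move=> x Ux; rewrite deriveD //; apply: diff_derivable.
  exact: df0.
exact: dg0.
Qed.

Lemma n_differentiableM k (f g : V -> R) :
  n_differentiable k f -> n_differentiable k g -> n_differentiable k (f * g).
Proof.
elim: k f g => [|k IH] f g df dg.
  split=> // x Ux.
  exact: differentiableM (n_differentiableW df Ux) (n_differentiableW dg Ux).
split=> [x Ux|v].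
  exact: differentiableM (n_differentiableW df Ux) (n_differentiableW dg Ux).
apply: (@eq_n_differentiable _ _ (f * 'D_v g + g * 'D_v f)).
  move=> x Ux; rewrite deriveM //.
  - exact/diff_derivable/(n_differentiableW df).
  - exact/diff_derivable/(n_differentiableW dg).
have [[_ Df] [_ Dg]] := (df, dg).
have [df' dg'] := (n_differentiable_pred df, n_differentiable_pred dg).
exact: n_differentiableD (IH _ _ df' (Dg v)) (IH _ _ dg' (Df v)).
Qed.

Lemma n_differentiable_sum (W : normedModType R) k n (f : 'I_n -> V -> W) :
  (forall i, n_differentiable k (f i)) -> n_differentiable k (\sum_i f i).
Proof.
move=> df; elim/big_ind: _ => //; last by move=> *; exact: n_differentiableD.
exact: n_differentiable_cst.
Qed.

Lemma differentiable_matrixP n m (F : V -> 'M[R]_(n, m)) x :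
  differentiable F x <-> forall i j, differentiable (fun y => F y i j) x.
Proof.
split=> [dF i j|dF].
  exact: (differentiable_comp dF (differentiable_coord _ _ _)).
have -> : F = \sum_i \sum_j (fun y => F y i j *: delta_mx i j).
  apply/funext => y; rewrite {1}[F y]matrix_sum_delta fct_sumE.
  by apply: eq_bigr => i _; rewrite fct_sumE.
by do 2 apply: differentiable_sum => ?; exact: differentiableZl.
Qed.

Lemma derive_coord n m (F : V -> 'M[R]_(n, m)) v i j :
  (forall x, U x -> differentiable F x) ->
  forall x, U x -> 'D_v F x i j = 'D_v (fun y => F y i j) x.
Proof.
by move=> dF x Ux; rewrite derive_mx ?mxE //; exact/diff_derivable/dF.
Qed.

Lemma n_differentiable_coord n m k (F : V -> 'M[R]_(n, m)) :
  n_differentiable k F <->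
  forall i j, n_differentiable k (fun y => F y i j).
Proof.
elim: k F => [|k IH] F.
  split=> [[dF _] i j|dF]; split=> // x Ux.
    by have /differentiable_matrixP := dF x Ux.
  by apply/differentiable_matrixP => i j; exact: (n_differentiableW (dF i j)).
split=> [[dF DF] i j|dF].
  split=> [x Ux|v]; first by have /differentiable_matrixP := dF x Ux.
  apply: eq_n_differentiable (proj1 (IH _) (DF v) i j).
  exact: derive_coord.
have dF1 x : U x -> differentiable F x.
  move=> Ux; apply/differentiable_matrixP => i j.
  exact: (n_differentiableW (dF i j)).
split=> // v; apply/IH => i j; have [_ /(_ v)] := dF i j.
by apply: eq_n_differentiable => x Ux; rewrite derive_coord.
Qed.

Lemma iter_derive_coord n m (F : V -> 'M[R]_(n, m)) vs i j :
  (forall vs x, U x -> differentiable (iter_derive F vs) x) ->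
  forall x, U x ->
  iter_derive F vs x i j = iter_derive (fun y => F y i j) vs x.
Proof.
move=> dF; elim: vs => //= v vs IH x Ux.
by rewrite derive_coord //; [exact: eq_derive_on|move=> y; exact: dF].
Qed.

End FiniteDifferentiability.

(** Linearity of the differential reduces every directional derivative to the
    partial derivatives, with coefficients that do not depend on the point. *)
Lemma derive_partials (R : realType) n (W : normedModType R)
    (f : 'cV[R]_n -> W) v x : differentiable f x ->
  'D_v f x = \sum_i v i 0 *: 'D_(delta_mx i 0) f x.
Proof.
move=> df; rewrite deriveE // {1}[v]matrix_sum_delta.
rewrite linear_sum; apply: eq_bigr => i _.
by rewrite big_ord1 linearZ deriveE.
Qed.

(** By the chain rule a derivative of [f \o G] is a sum of products of a
    derivative of an entry of [G] with a partial derivative of [f] composed with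
    [G]; the latter is covered by the induction hypothesis, which must therefore
    be general in [f]. *)
Lemma n_differentiable_comp (R : realType) n (V : normedModType R) (U : set V)
    (U' : set 'cV[R]_n) k (G : V -> 'cV[R]_n) (f : 'cV[R]_n -> R) :
  open U -> (forall x, U x -> U' (G x)) ->
  n_differentiable U k G -> n_differentiable U' k f ->
  n_differentiable U k (f \o G).
Proof.
move=> oU GU; elim: k f G GU => [|k IH] f G GU dG df.
  split=> // x Ux; apply: differentiable_comp.
    exact: (n_differentiableW dG).
  exact/(n_differentiableW df)/GU.
have dcomp x : U x -> differentiable (f \o G) x.
  move=> Ux; apply: differentiable_comp.
    exact: (n_differentiableW dG).
  exact/(n_differentiableW df)/GU.
split=> // v.
apply: (@eq_n_differentiable _ _ _ oU _ _
  (\sum_i (fun x => 'D_v G x i 0) * ('D_(delta_mx i 0) f \o G))).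
  move=> x Ux; rewrite deriveE; last exact: dcomp.
  have dGx := n_differentiableW dG Ux.
  have dfx := n_differentiableW df (GU _ Ux).
  rewrite diff_comp //= -deriveE // -deriveE // derive_partials //.
  by rewrite fct_sumE.
have [[_ DG] [_ Df]] := (dG, df).
apply: n_differentiable_sum => // i; apply: n_differentiableM => //.
  by have /(n_differentiable_coord oU) := DG v.
exact: IH GU (n_differentiable_pred dG) (Df _).
Qed.

(** * Taylor's formula with a bound on the remainder *)

Section TaylorLine.
Variable R : realType.

Definition taylor_poly (a : nat -> R) N : {poly R} :=
  \poly_(j < N) ((j`!%:R)^-1 * a j).

Lemma deriv_taylor_poly a N :
  (taylor_poly a N.+1)^`() = taylor_poly (fun j => a j.+1) N.
Proof.
apply/polyP => j; rewrite coef_deriv !coef_poly ltnS; case: ifP => _;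
  last by rewrite mul0rn.
rewrite factS natrM invfM -[LHS]mulr_natl !mulrA divff ?mul1r // pnatr_eq0.
Qed.

Lemma taylor_poly0 a N : (taylor_poly a N.+1).[0] = a 0%N.
Proof. by rewrite horner_coef0 coef_poly /= fact0 invr1 mul1r. Qed.

(** The derivative of the remainder of order [N.+1] of [g 0] is the remainder of
    order [N] of [g 1], so the mean value theorem gives one factor [t] at each
    step.  Only the order of the error matters, hence
    no factorial in the bound. *)
Lemma taylor_line (d M : R) N (g : nat -> R -> R) :
  (forall j s, (j < N)%N -> 0 <= s <= d -> is_derive s 1 (g j) (g j.+1 s)) ->
  (forall s, 0 <= s <= d -> `|g N s| <= M) ->
  forall t, 0 <= t <= d ->
    `|g 0%N t - (taylor_poly (fun j => g j 0) N).[t]| <= M * t ^+ N.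
Proof.
elim: N g => [|N IH] g Dg gM t /andP[t0 td].
  rewrite /taylor_poly poly_def big_ord0 horner0 subr0 expr0 mulr1.
  by apply: gM; rewrite t0.
set p := taylor_poly _ _.
have Dh s : 0 <= s <= d ->
    is_derive s 1 (g 0%N - horner p) (g 1%N s - p^`().[s]).
  by move=> sd; have ? := Dg 0%N s erefl sd; apply: is_deriveB.
have contH : {within `[0, t], continuous (g 0%N - horner p : R -> R)}.
  apply: derivable_within_continuous => s; rewrite in_itv /= => /andP[s0 st].
  by have [] := Dh s; rewrite ?s0 ?(le_trans st).
have DhI s : s \in `]0, t[%R ->
    is_derive s 1 (g 0%N - horner p) (g 1%N s - p^`().[s]).
  rewrite in_itv /= => /andP[/ltW s0 /ltW st].
  by apply: Dh; rewrite s0 (le_trans st).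
(* The remainder vanishes at 0, hence its value at [t] is its derivative at an
   intermediate point [c] times [t]. *)
have [c] := MVT_segment t0 DhI contH.
rewrite in_itv /= => /andP[c0 ct].
rewrite !fctE /p taylor_poly0 subrr !subr0 => ->.
rewrite deriv_taylor_poly normrM (ger0_norm t0) exprSr mulrA ler_wpM2r //.
have cd : 0 <= c <= d by rewrite c0 (le_trans ct).
have Dg' j s : (j < N)%N -> 0 <= s <= d -> is_derive s 1 (g j.+1) (g j.+2 s).
  by move=> jN; exact: Dg.
rewrite (le_trans (IH (fun j => g j.+1) Dg' gM c cd)) // ler_wpM2l //.
  exact: le_trans (normr_ge0 _) (gM c cd).
by rewrite lerXn2r.
Qed.

Lemma is_derive_line (V W : normedModType R) (f : V -> W) y s :
  differentiable f (s *: y) ->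
  is_derive s 1 (fun t : R => f (t *: y)) ('D_y f (s *: y)).
Proof.
move=> df; have sy : differentiable (fun t : R => t *: y) s by [].
have dfy : differentiable (f \o (fun t : R => t *: y)) s.
  exact: differentiable_comp.
apply: DeriveDef; first exact: diff_derivable.
rewrite [LHS]deriveE // diff_comp //= [in RHS]deriveE // diff_val /=.
by rewrite scale1r.
Qed.

End TaylorLine.

Lemma normr_coord_le (R : realType) m n (y : 'M[R]_(m, n)) i j :
  `|y i j| <= `|y|.
Proof.
rewrite [leRHS]/Num.Def.normr /= mx_normrE.
exact: (le_bigmax _ (fun ij => `|y ij.1 ij.2|) (i, j)).
Qed.

Section TaylorSpace.
Variables (R : realType) (V : normedModType R) (U : set V).
Hypothesis openU : open U.

Lemma iter_deriveD k (W : normedModType R) (f g : V -> W) vs :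
  n_differentiable U k f -> n_differentiable U k g -> (size vs <= k.+1)%N ->
  forall x, U x ->
  iter_derive (f + g) vs x = iter_derive f vs x + iter_derive g vs x.
Proof.
move=> df dg; elim: vs => //= v vs IH sz x Ux.
rewrite (eq_derive_on openU _ (IH (ltnW sz))) //.
have /n_differentiableP dfk := df; have /n_differentiableP dgk := dg.
by rewrite deriveD //; apply: diff_derivable; [exact: dfk|exact: dgk].
Qed.

Lemma iter_deriveZ k (W : normedModType R) (f : V -> W) c vs :
  n_differentiable U k f -> (size vs <= k.+1)%N ->
  forall x, U x -> iter_derive (c *: f) vs x = c *: iter_derive f vs x.
Proof.
move=> df; elim: vs => //= v vs IH sz x Ux.
rewrite (eq_derive_on openU _ (IH (ltnW sz))) //.
have /n_differentiableP dfk := df.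
by rewrite deriveZ //; apply: diff_derivable; exact: dfk.
Qed.

Lemma iter_derive_cst0 (W : normedModType R) vs :
  iter_derive (0 : V -> W) vs = 0.
Proof.
by elim: vs => //= v vs ->; apply/funext => x; rewrite derive_cst.
Qed.

Lemma n_differentiableZ (W : normedModType R) k c (f : V -> W) :
  n_differentiable U k f -> n_differentiable U k (c *: f).
Proof.
move=> df; apply/n_differentiableP => vs x sz Ux.
have /n_differentiableP dfk := df.
apply: (@near_eq_differentiable _ _ _ (c *: iter_derive f vs)).
  by apply: open_near Ux => // y Uy; rewrite (iter_deriveZ _ df) // ltnW.
by apply: differentiableZ; exact: dfk.
Qed.

Lemma iter_derive_sum n k (W : normedModType R) (f : 'I_n -> V -> W) vs :
  (forall i, n_differentiable U k (f i)) -> (size vs <= k.+1)%N ->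
  forall x, U x ->
  iter_derive (\sum_i f i) vs x = \sum_i iter_derive (f i) vs x.
Proof.
move=> df sz x Ux.
suff [] : n_differentiable U k (\sum_i f i) /\
  iter_derive (\sum_i f i) vs x = \sum_i iter_derive (f i) vs x by [].
elim/big_rec2: _ => [|i y1 y2 _ [dy2 IH]].
  by rewrite iter_derive_cst0; split=> //; exact: n_differentiable_cst.
split; first exact: n_differentiableD.
by rewrite (iter_deriveD (df i) dy2) // IH.
Qed.

End TaylorSpace.

Section TaylorColumn.
Variables (R : realType) (n : nat) (U : set 'cV[R]_n).
Hypothesis openU : open U.
Hypothesis U0 : U 0.

(** The direction [y] varies, so continuity does not give a uniform bound at once.
    Expanding the [k] derivatives along the basis leaves finitely many partial
    derivatives, each bounded near the origin, with coefficients that are products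
    of [k] entries of [y]. *)
Lemma iter_derive_le k (f : 'cV[R]_n -> R) : n_differentiable U k f ->
  exists2 C, 0 <= C &
    \forall z \near 0, forall y, `|iter_derive f (nseq k y) z| <= C * `|y| ^+ k.
Proof.
elim: k f => [|k IH] f df.
  exists (`|f 0| + 1); first by rewrite addr_ge0.
  have /differentiable_continuous/cvgrPdist_lt/(_ 1 ltr01) :=
    n_differentiableW df U0.
  apply: filterS => z fz y /=; rewrite expr0 mulr1 -lerBlDl.
  by rewrite (le_trans (lerB_dist _ _)) // distrC ltW.
have [df0 Df] := df.
have /choice[C HC] : forall i : 'I_n, exists C, 0 <= C /\
    \forall z \near 0, forall y,
      `|iter_derive ('D_(delta_mx i 0) f) (nseq k y) z| <= C * `|y| ^+ k.
  by move=> i; have [C C0 HC] := IH _ (Df (delta_mx i 0)); exists C.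
exists (\sum_i C i); first by apply: sumr_ge0 => i _; have [] := HC i.
have nearC := filter_forall _ (fun i => proj2 (HC i)).
near=> z => y.
have Uz : U z by near: z; exact: open_nbhs_nbhs.
have HCz : forall i y,
   `|iter_derive ('D_(delta_mx i 0) f) (nseq k y) z| <= C i * `|y| ^+ k.
  by near: z; exact: nearC.
have -> : nseq k.+1 y = rcons (nseq k y) y by elim: (k) => //= j ->.
rewrite iter_derive_rcons.
rewrite (@eq_iter_derive_on _ _ _ openU _ _
    (\sum_i y i 0 *: 'D_(delta_mx i 0) f)) //; last first.
  by move=> w Uw; rewrite derive_partials ?fct_sumE //; exact: df0.
rewrite (@iter_derive_sum _ _ _ openU _ k) ?size_nseq //; last first.
  by move=> i; apply: n_differentiableZ => //; exact: Df.
rewrite (le_trans (ler_norm_sum _ _ _)) // mulr_suml ler_sum // => i _.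
rewrite (@iter_deriveZ _ _ _ openU k) ?size_nseq //; last exact: Df.
rewrite normrM exprS mulrCA ler_pM //.
exact: normr_coord_le.
Unshelve. all: by end_near.
Qed.

(** Taylor's formula on the segment from 0 to [y], as a function of the parameter
    in [[0, 1]]; the powers of [y] are in the coefficients, so that the Taylor
    polynomial is evaluated at 1. *)
Lemma taylor_column N (f : 'cV[R]_n -> R) : n_differentiable U N f ->
  exists2 C, 0 <= C & \forall y \near (0 : 'cV[R]_n),
    `|f y - (taylor_poly (fun j => iter_derive f (nseq j y) 0) N).[1]|
      <= C * `|y| ^+ N.
Proof.
move=> df; have [C C0 nearC] := iter_derive_le df; exists C => //.
have nU : \forall z \near (0 : 'cV[R]_n), U z by exact: open_nbhs_nbhs.
have /nbhs_normP[e /= e0 ball_e] : \forall z \near (0 : 'cV[R]_n), U z /\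
    forall y, `|iter_derive f (nseq N y) z| <= C * `|y| ^+ N by exact: filterI.
have near_lt : \forall y \near (0 : 'cV[R]_n), `|y| < e.
  by apply/nbhs_normP; exists e => // z /=; rewrite sub0r normrN.
near=> y.
have ye : `|y| < e by near: y; exact: near_lt.
have line s : 0 <= s <= 1 -> `|0 - s *: y| < e.
  move=> /andP[s0 s1]; rewrite sub0r normrN normrZ ger0_norm //.
  by rewrite (le_lt_trans _ ye) // ler_piMl.
have := @taylor_line R 1 (C * `|y| ^+ N) N
  (fun j s => iter_derive f (nseq j y) (s *: y)) _ _ 1.
rewrite /= expr1n mulr1 scale1r scale0r; apply; last by rewrite ler01 lexx.
  move=> j s jN /line/ball_e[Us _].
  apply: is_derive_line; have /n_differentiableP := df; apply => //.
  by rewrite size_nseq ltnW.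
by move=> s /line/ball_e[_]; apply.
Unshelve. all: by end_near.
Qed.

End TaylorColumn.

(** * Polynomial approximations at 0 of functions of one variable *)

Section Jets.
Variable R : realType.

(** Positive [t] are enough to determine the coefficients, and make absolute
    values unnecessary in the error term. *)
Definition has_jet N (a : R -> R) (p : {poly R}) :=
  exists2 C, 0 <= C & \forall t \near 0^'+, `|a t - p.[t]| <= C * t ^+ N.

Lemma has_jet_cst N c : has_jet N (fun=> c) c%:P.
Proof.
by exists 0 => //; near=> t; rewrite hornerC subrr normr0 mul0r.
Unshelve. all: by end_near.
Qed.

Lemma has_jetD N a b p q :
  has_jet N a p -> has_jet N b q -> has_jet N (fun t => a t + b t) (p + q).
Proof.
move=> [C C0 ap] [D D0 bq]; exists (C + D); first by rewrite addr_ge0.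
near=> t; rewrite hornerD opprD addrACA mulrDl (le_trans (ler_normD _ _)) //.
by rewrite lerD //; near: t.
Unshelve. all: by end_near.
Qed.

Lemma horner_bounded (p : {poly R}) :
  exists2 B, 0 <= B & \forall t \near 0^'+, `|p.[t]| <= B.
Proof.
exists (`|p.[0]| + 1); first by rewrite addr_ge0.
apply: cvg_within.
have /cvgrPdist_lt/(_ 1 ltr01) : horner p @ 0 --> p.[0] by exact: continuous_horner.
apply: filterS => t pt; rewrite -lerBlDl.
by rewrite (le_trans (lerB_dist _ _)) // distrC ltW.
Qed.

Lemma has_jetM N a b p q :
  has_jet N a p -> has_jet N b q -> has_jet N (fun t => a t * b t) (p * q).
Proof.
move=> [C C0 ap] [D D0 bq].
have [[P P0 pP] [Q Q0 qQ]] := (horner_bounded p, horner_bounded q).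
exists (C * (Q + D) + P * D); first by rewrite addr_ge0 ?mulr_ge0 ?addr_ge0.
near=> t.
have t0 : 0 < t by near: t; exact: nbhs_right_gt.
have t1 : t <= 1 by near: t; exact: nbhs_right_le.
have apt : `|a t - p.[t]| <= C * t ^+ N by near: t.
have bqt : `|b t - q.[t]| <= D * t ^+ N by near: t.
have pPt : `|p.[t]| <= P by near: t.
have qQt : `|q.[t]| <= Q by near: t.
have tN1 : t ^+ N <= 1 by rewrite exprn_ile1 // ltW.
have tN0 : 0 <= t ^+ N by rewrite exprn_ge0 // ltW.
have bt : `|b t| <= Q + D.
  rewrite -[b t](subrK q.[t]) addrC (le_trans (ler_normD _ _)) // lerD //.
  by rewrite (le_trans bqt) // ler_piMr.
have -> : a t * b t - (p * q).[t] =
    (a t - p.[t]) * b t + p.[t] * (b t - q.[t]).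
  by rewrite hornerM mulrBl mulrBr addrA subrK.
rewrite (le_trans (ler_normD _ _)) // !normrM mulrDl lerD //.
  by rewrite mulrAC ler_pM.
by rewrite -mulrA ler_pM.
Unshelve. all: by end_near.
Qed.

Lemma has_jet_sum N (I : Type) (s : seq I) (P : pred I) (a : I -> R -> R)
    (p : I -> {poly R}) : (forall i, P i -> has_jet N (a i) (p i)) ->
  has_jet N (fun t => \sum_(i <- s | P i) a i t) (\sum_(i <- s | P i) p i).
Proof.
move=> ap; elim: s => [|i s IH].
  rewrite big_nil; under eq_fun do rewrite big_nil.
  exact: has_jet_cst.
rewrite big_cons; under eq_fun do rewrite big_cons.
by case: ifP => // Pi; apply: has_jetD => //; exact: ap.
Qed.

Lemma has_jet_prod N (I : Type) (s : seq I) (a : I -> R -> R)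
    (p : I -> {poly R}) : (forall i, has_jet N (a i) (p i)) ->
  has_jet N (fun t => \prod_(i <- s) a i t) (\prod_(i <- s) p i).
Proof.
move=> ap; elim: s => [|i s IH].
  rewrite big_nil; under eq_fun do rewrite big_nil.
  exact: has_jet_cst.
rewrite big_cons; under eq_fun do rewrite big_cons.
exact: has_jetM.
Qed.

(** Letting [t] tend to 0 kills the constant term; then [p = q * 'X] with [q]
    small of order [N]. *)
Lemma horner_small_coef N (p : {poly R}) C :
  (\forall t \near 0^'+, `|p.[t]| <= C * t ^+ N) ->
  forall i, (i < N)%N -> p`_i = 0.
Proof.
elim: N p => [//|N IH] p small.
have p0 : p.[0] = 0.
  apply/eqP; rewrite -normr_le0; apply/ler_addgt0Pl => e e0; rewrite addr0.
  have pc : `|p.[t]| @[t --> 0^'+] --> `|p.[0]|.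
    by apply: cvg_norm; apply: cvg_at_right_filter; exact: continuous_horner.
  have Ct : (C * t ^+ N.+1) @[t --> 0^'+] --> C * 0 ^+ N.+1.
    apply: cvgMr; apply: cvg_at_right_filter; exact: exprn_continuous.
  rewrite (le_trans (ler_cvg_to pc Ct small)) //.
  by rewrite expr0n mulr0 ltW.
have /factor_theorem[q pE] : root p 0 by rewrite rootE p0.
rewrite subr0 in pE.
have q_small : \forall t \near 0^'+, `|q.[t]| <= C * t ^+ N.
  near=> t.
  have t0 : 0 < t by near: t; exact: nbhs_right_gt.
  have : `|p.[t]| <= C * t ^+ N.+1 by near: t.
  rewrite pE hornerMX normrM (gtr0_norm t0) exprSr mulrA.
  by rewrite ler_pM2r.
case=> [|i] iN; rewrite pE coefMX //=.
exact: IH.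
Unshelve. all: by end_near.
Qed.

Lemma has_jet_unique N a p q : has_jet N a p -> has_jet N a q ->
  forall i, (i < N)%N -> p`_i = q`_i.
Proof.
move=> [C C0 ap] [D D0 aq] i iN; apply/eqP; rewrite -subr_eq0 -coefB.
apply/eqP; apply: (@horner_small_coef N _ (C + D)) => //.
near=> t; rewrite hornerD hornerN.
have -> : p.[t] - q.[t] = (a t - q.[t]) - (a t - p.[t]).
  by rewrite opprB [RHS]addrC addrA subrK.
rewrite (le_trans (ler_normB _ _)) // addrC mulrDl lerD //; near: t => //.
Unshelve. all: by end_near.
Qed.

(** The constant is a bound of the last derivative around 0, which exists by
    continuity. *)
Lemma has_jet_line (V : normedModType R) (U : set V) N (f : V -> R) x :
  open U -> U 0 -> n_differentiable U N f ->
  has_jet N (fun t => f (t *: x))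
    (taylor_poly (fun j => iter_derive f (nseq j x) 0) N).
Proof.
move=> oU U0 df; have /n_differentiableP dfN := df.
have line_cvg : (fun t : R => t *: x) @ 0 --> (0 *: x : V).
  by apply: cvgZl; exact: cvg_id.
have Nc : (fun t : R => `|iter_derive f (nseq N x) (t *: x)|) @ 0 -->
    `|iter_derive f (nseq N x) (0 *: x)|.
  apply: cvg_norm; apply: (cvg_comp _ _ line_cvg).
  apply/differentiable_continuous/dfN; rewrite ?size_nseq ?scale0r //.
have [C C0 nearC] : exists2 C, 0 <= C &
    \forall s \near 0, `|iter_derive f (nseq N x) (s *: x)| <= C.
  exists (`|iter_derive f (nseq N x) (0 *: x)| + 1); first by rewrite addr_ge0.
  have /cvgrPdist_lt/(_ 1 ltr01) := Nc.
  apply: filterS => t pt; rewrite -lerBlDl.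
  by rewrite (le_trans (ler_norm _)) // distrC ltW.
have open_near0 : \forall s \near (0 : R), U (s *: x).
  by apply: line_cvg; rewrite scale0r; exact: open_nbhs_nbhs.
have /nbhs_normP[e /= e0 ball_e] : \forall s \near (0 : R), U (s *: x) /\
    `|iter_derive f (nseq N x) (s *: x)| <= C by exact: filterI.
exists C => //; near=> t.
have t0 : 0 < t by near: t; exact: nbhs_right_gt.
have te : t < e by near: t; exact: nbhs_right_lt.
have inball s : 0 <= s <= t -> `|0 - s| < e.
  by move=> /andP[s0 st]; rewrite sub0r normrN ger0_norm // (le_lt_trans st).
have := @taylor_line R t C N (fun j s => iter_derive f (nseq j x) (s *: x)) _ _ t.
rewrite /= scale0r; apply; last by rewrite ltW // lexx.
  move=> j s jN /inball/ball_e[Us _].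
  by apply: is_derive_line; apply: dfN => //; rewrite size_nseq ltnW.
by move=> s /inball/ball_e[].
Unshelve. all: by end_near.
Qed.

End Jets.

(** * Entries of Kronecker powers, products and sums *)

Section KroneckerEntries.
Variable R : realType.

(** The digits of [r] in base [n], the most significant first.  They are defined
    through [mxtens_unindex] because this is how the tensor product splits its
    indices. *)
Fixpoint kron_digits n p : 'I_(n ^ p) -> seq 'I_n :=
  match p with
  | 0 => fun=> [::]
  | p'.+1 => fun r =>
      let u := mxtens_unindex (cast_ord (expnS n p') r) in
      u.1 :: kron_digits u.2
  end.

Lemma kron_digitsS n p (r : 'I_(n ^ p.+1)) :
  let u := mxtens_unindex (cast_ord (expnS n p) r) in
  kron_digits r = u.1 :: kron_digits u.2.
Proof. by []. Qed.

Lemma size_kron_digits n p (r : 'I_(n ^ p)) : size (kron_digits r) = p.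
Proof. by elim: p r => //= p IH r; rewrite IH. Qed.

Lemma ntensmx_recE n (x : 'cV[R]_n) p r j :
  ntensmx_rec x p r j = \prod_(d <- kron_digits (r : 'I_(n ^ p.+1))) x d 0.
Proof.
elim: p r j => [|p IH] r j.
  rewrite /= big_cons big_nil mulr1; congr (x _ _).
    by apply: val_inj; rewrite /= divn1.
  by apply: val_inj; case: j => [[]].
rewrite [ntensmx_rec _ _]/= kron_digitsS big_cons mxE.
congr (x _ _ * _).
- by apply: val_inj.
- by rewrite [LHS]ord1.
rewrite IH; set s := kron_digits _; set s' := kron_digits _.
by have -> : s = s' by congr kron_digits; apply: val_inj.
Qed.

Lemma kron_powE n (x : 'cV[R]_n) p r :
  kron_pow x p r 0 = \prod_(d <- kron_digits r) x d 0.
Proof.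
rewrite /kron_pow castmxE; case: p r => [|p] r.
  rewrite big_nil /= mxE.
  by rewrite [X in _ *+ X](_ : _ = 1%N) //; case: r => [[]].
rewrite [x ^t _]/(ntensmx_rec x p) ntensmx_recE.
set s := kron_digits _; set s' := kron_digits _.
by have -> : s = s' by congr kron_digits; apply: val_inj.
Qed.

(** Kronecker products are associative: reading the leading digit commutes with
    splitting off the last [q] digits, both being
    [a1 * n ^ (i + q) + a2 * n ^ q + b] on the underlying integers. *)
Lemma kron_digits_cat n i q (a : 'I_(n ^ i)) (b : 'I_(n ^ q)) :
  kron_digits (cast_ord (esym (expnD n i q)) (mxtens_index (a, b)))
    = kron_digits a ++ kron_digits b.
Proof.
elim: i a => [|i IH] a.
  by congr kron_digits; apply: val_inj; case: a => [[]].
case aE : (mxtens_unindex (cast_ord (expnS n i) a)) => [a1 a2].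
have aV : cast_ord (expnS n i) a = mxtens_index (a1, a2).
  by rewrite -aE mxtens_unindexK.
rewrite [kron_digits a]kron_digitsS aE [LHS](@kron_digitsS n (i + q)).
set r := cast_ord _ _.
have -> : r = mxtens_index
    (a1, cast_ord (esym (expnD n i q)) (mxtens_index (a2, b))).
  apply: val_inj; rewrite /=.
  by have /= -> := congr1 val aV; rewrite expnD mulnDl mulnA addnA.
by rewrite mxtens_indexK /= -IH.
Qed.

Lemma kron_powD n (x : 'cV[R]_n) i q :
  kron_pow x (i + q) =
  castmx (esym (expnD n i q), muln1 1%N) (kron_pow x i *t kron_pow x q).
Proof.
apply/matrixP => r j; rewrite [j]ord1 kron_powE castmxE.
rewrite -[r](cast_ordK (expnD n i q)).
case: (mxtens_indexP (cast_ord _ r)) => a b.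
rewrite kron_digits_cat big_cat /= -!kron_powE esymK.
rewrite (cast_ordKV (expnD n i q)).
have -> : cast_ord (esym (muln1 1%N)) 0 = mxtens_index (0 : 'I_1, 0 : 'I_1).
  by apply: val_inj.
by rewrite tensmxE.
Qed.

Lemma mulmx_castmx m m' k k' l l' (e1 : m = m') (e2 : k = k') (e3 : l = l')
    (M : 'M[R]_(m, k)) (N : 'M[R]_(k, l)) :
  castmx (e1, e2) M *m castmx (e2, e3) N = castmx (e1, e3) (M *m N).
Proof. by case: _ / e1; case: _ / e2; case: _ / e3. Qed.

(** The mixed-product rule [(A (x) B) (u (x) v) = (A u) (x) (B v)], iterated along
    [s]. *)
Lemma kron_prodE n m (A : forall k, 'M[R]_(n, m ^ k)) (x : 'cV[R]_m) s r :
  (kron_prod A s *m kron_pow x (sumn s)) r 0 =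
  \prod_(ld <- zip s (kron_digits r)) (A ld.1 *m kron_pow x ld.1) ld.2 0.
Proof.
elim: s r => [|i s IH] r.
  rewrite mul1mx [RHS]big_nil; apply: etrans (@kron_powE m x 0 r) _.
  by rewrite big_nil.
rewrite [sumn _]/= kron_powD [kron_prod _ _]/= mulmx_castmx tensmx_mul castmxE.
rewrite kron_digitsS esymK.
case: (mxtens_indexP (cast_ord _ r)) => a b.
rewrite mxtens_indexK /= big_cons -IH /=.
have -> : cast_ord (esym (muln1 1%N)) 0 = mxtens_index (0 : 'I_1, 0 : 'I_1).
  by apply: val_inj.
by rewrite tensmxE.
Qed.

(** Expanding the product chooses one positive degree for each factor; the tuples
    of degrees that contribute to the coefficient of degree [q] are those of sum
    [q], and degrees above [q] cannot occur in them. *)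
Lemma coef_prod_series (S : comNzRingType) (I : Type) (c : nat -> I -> S) p q
    (ds : p.-tuple I) :
  (\prod_(d <- ds) \sum_(l < q.+1 | (0 < l)%N) c l d *: 'X^l)`_q =
  \sum_(i : p.-tuple 'I_q.+1 |
        all (fun k : 'I_q.+1 => 0 < k)%N i && (sumn (map val i) == q))
    \prod_(ld <- zip (map val i) ds) c ld.1 ld.2.
Proof.
rewrite big_tuple bigA_distr_big coef_sum.
pose tup (f : {ffun 'I_p -> 'I_q.+1}) := [tuple f k | k < p].
pose fin (i : p.-tuple 'I_q.+1) := [ffun k => tnth i k].
rewrite [RHS](reindex tup) /=; last first.
  exists fin => i _; first by apply/ffunP => k; rewrite ffunE tnth_mktuple.
  by apply: eq_from_tnth => k; rewrite tnth_mktuple ffunE.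
rewrite big_mkcond [RHS]big_mkcond; apply: eq_bigr => f _ /=.
have -> : (f \in ffun_on (fun l : 'I_q.+1 => 0 < l)%N) =
    all (fun k : 'I_q.+1 => 0 < k)%N (tup f).
  apply/ffun_onP/all_tnthP => H k; first by rewrite tnth_mktuple; exact: H.
  by have := H k; rewrite tnth_mktuple.
have -> : sumn (map val (tup f)) = (\sum_k f k)%N.
  by rewrite sumnE big_map big_tuple; apply: eq_bigr => k _; rewrite tnth_mktuple.
have -> : \prod_k (c (f k) (tnth ds k) *: 'X^(f k)) =
    (\prod_k c (f k) (tnth ds k)) *: 'X^(\sum_k f k) :> {poly S}.
  by rewrite scaler_prod expr_sum.
have -> : \prod_(ld <- zip (map val (tup f)) ds) c ld.1 ld.2 =
    \prod_k c (f k) (tnth ds k).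
  have : forall k, tnth (tup f) k = f k by move=> k; rewrite tnth_mktuple.
  move: (tup f) => i iE.
  rewrite (big_tuple _ _ (zip_tuple (map_tuple val i) ds)).
  apply: eq_bigr => k _.
  rewrite (tnth_nth (val (f k), tnth ds k)) /= nth_zip ?size_map ?size_tuple //=.
  rewrite (nth_map (f k)) ?size_tuple // -!tnth_nth iE.
  by [].
rewrite coefZ coefXn eq_sym; case: (all _ _) => //=.
by case: eqP => _; rewrite ?mulr1 ?mulr0.
Qed.

(** The sum of tensor products is exactly what substitution into a monomial of
    degree [p] produces in degree [q]. *)
Lemma kron_sumE n m (A : forall k, 'M[R]_(n, m ^ k)) (x : 'cV[R]_m) p q r :
  (kron_sum A p q *m kron_pow x q) r 0 =
  (\prod_(d <- kron_digits r)
     \sum_(l < q.+1 | (0 < l)%N) (A l *m kron_pow x l) d 0 *: 'X^l)`_q.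
Proof.
have szr : size (kron_digits r) == p by rewrite size_kron_digits.
rewrite (coef_prod_series (fun l d => (A l *m kron_pow x l) d 0) _ (Tuple szr)).
rewrite mulmx_suml summxE; apply: eq_bigr => i /andP[_ /eqP sumi].
have szi : size (map val i) = p by rewrite size_map size_tuple.
rewrite /=; move: (map val i) szi sumi => s szs sums {i szr}.
by case: _ / szs r; case: _ / sums => r; rewrite conform_mx_id kron_prodE.
Qed.

End KroneckerEntries.

(** * Composition of Kronecker expansions *)

Section Composition.
Variable R : realType.

(** [G] is continuous at 0 and [G 0 = 0], so that around 0 it takes its values
    where [F] is smooth. *)
Lemma smooth_near0_comp n m q (F : 'cV[R]_n -> 'cV[R]_q)
    (G : 'cV[R]_m -> 'cV[R]_n) :
  smooth_near0 F -> smooth_near0 G -> G 0 = 0 -> smooth_near0 (F \o G).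
Proof.
move=> [UF [oUF UF0] sF] [UG [oUG UG0] sG] G0.
pose U := interior (UG `&` G @^-1` UF).
have oU : open U by exact: open_interior.
have UUG : U `<=` UG by move=> x /interior_subset[].
have UUF x : U x -> UF (G x) by move=> /interior_subset[].
exists U.
  split=> //; apply: filterI; first exact: open_nbhs_nbhs.
  have cG : {for 0, continuous G}.
    by apply: differentiable_continuous; exact: (sG [::]).
  by apply: cG; rewrite /= G0; exact: open_nbhs_nbhs.
have dF k : n_differentiable UF k F.
  by apply/n_differentiableP => vs x _; exact: sF.
have dG k : n_differentiable U k G.
  by apply/n_differentiableP => vs x _ /UUG; exact: sG.
move=> vs x; suff /n_differentiableP : n_differentiable U (size vs) (F \o G).
  by move=> /(_ vs x (leqnn _)).
apply/(n_differentiable_coord oU) => i j.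
have /(n_differentiable_coord oUF) dFi := dF (size vs).
exact: (n_differentiable_comp oU UUF (dG _) (dFi i j)).
Qed.

Lemma mx_norm_le m n (y : 'M[R]_(m, n)) B :
  0 <= B -> (forall i j, `|y i j| <= B) -> `|y| <= B.
Proof.
move=> B0 yB; rewrite [leLHS]/Num.Def.normr /= mx_normrE.
by apply: bigmax_le => // -[i j] _; exact: yB.
Qed.

Lemma taylor_part_coord (V : normedModType R) n (F : V -> 'cV[R]_n) k x i :
  smooth_near0 F ->
  taylor_part F k x i 0 =
  (k`!%:R)^-1 * iter_derive (fun y => F y i 0) (nseq k x) 0.
Proof.
by move=> [U [oU U0] sF]; rewrite mxE (iter_derive_coord oU).
Qed.

Lemma smooth_near0_coord (V : normedModType R) n (F : V -> 'cV[R]_n) :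
  smooth_near0 F -> exists U : set V, [/\ open U, U 0 &
    forall k i, n_differentiable U k (fun y => F y i 0)].
Proof.
move=> [U [oU U0] sF]; exists U; split=> // k i.
have : n_differentiable U k F by apply/n_differentiableP => vs x _; exact: sF.
by move=> /(n_differentiable_coord oU)/(_ i 0).
Qed.

Lemma coef_taylor_poly (a : nat -> R) N j : (j < N)%N ->
  (taylor_poly a N)`_j = (j`!%:R)^-1 * a j.
Proof. by move=> jN; rewrite coef_poly jN. Qed.

(** The hypothesis [G 0 = 0] removes the constant term, which is why only positive
    degrees remain. *)
Lemma curve_jet m n (G : 'cV[R]_m -> 'cV[R]_n)
    (A : forall k, 'M[R]_(n, m ^ k)) x k d : has_kron_expansion G A ->
  has_jet k.+1 (fun t => G (t *: x) d 0)
    (\sum_(l < k.+1 | (0 < l)%N) (A l *m kron_pow x l) d 0 *: 'X^l).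
Proof.
move=> [sG G0 GA]; have [U [oU U0 dG]] := smooth_near0_coord sG.
have := has_jet_line x oU U0 (dG k.+1 d).
congr has_jet; rewrite /taylor_poly poly_def [RHS]big_mkcond.
apply: eq_bigr => -[[|l] lk] _ /=.
  by rewrite G0 mxE mulr0 scale0r.
by rewrite -(taylor_part_coord _ _ _ sG) GA.
Qed.

(** The approximation of order 1 of each entry is 0. *)
Lemma curve_le m n (G : 'cV[R]_m -> 'cV[R]_n)
    (A : forall k, 'M[R]_(n, m ^ k)) x : has_kron_expansion G A ->
  exists2 C, 0 <= C & \forall t \near 0^'+, `|G (t *: x)| <= C * t.
Proof.
move=> GA.
have /choice[C HC] d : exists C, 0 <= C /\
    \forall t \near 0^'+, `|G (t *: x) d 0| <= C * t.
  have [C C0 nearC] := curve_jet x 0 d GA; exists C; split => //.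
  apply: filterS nearC => t.
  rewrite big_pred0 => [|[[|l] ?] //].
  by rewrite horner0 subr0 expr1.
have C0 : 0 <= \sum_d C d by apply: sumr_ge0 => d _; have [] := HC d.
exists (\sum_d C d) => //.
have nearC := filter_forall _ (fun d => proj2 (HC d)).
near=> t.
have t0 : 0 <= t by near: t; exact: nbhs_right_ge.
have HCt : forall d, `|G (t *: x) d 0| <= C d * t by near: t; exact: nearC.
apply: mx_norm_le => [|d j]; first exact: mulr_ge0.
rewrite [j]ord1 (le_trans (HCt d)) // ler_wpM2r // (bigD1 d) //= lerDl.
by apply: sumr_ge0 => i _; have [] := HC i.
Unshelve. all: by end_near.
Qed.

Lemma taylor_poly1 n q (F : 'cV[R]_n -> 'cV[R]_q)
    (T : forall k, 'M[R]_(q, n ^ k)) N r y : has_kron_expansion F T ->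
  (taylor_poly (fun j => iter_derive (fun z => F z r 0) (nseq j y) 0) N).[1] =
  \sum_(j < N | (0 < j)%N)
    \sum_c T j r c * \prod_(d <- kron_digits c) y d 0.
Proof.
move=> [sF F0 FT]; rewrite horner_poly [RHS]big_mkcond.
apply: eq_bigr => -[[|j] jN] _ /=.
  by rewrite F0 mxE mulr0 mul0r.
rewrite expr1n mulr1 -(taylor_part_coord _ _ _ sF) FT // mxE.
by apply: eq_bigr => c _; rewrite kron_powE.
Qed.

(** The entry [r] of [F (G (t *: x))] is approximated up to [O(t ^+ k.+1)] by the
    Taylor polynomial of [F \o G] in the direction [x], and also by the result of
    substituting the Taylor polynomials of the entries of [G] into that of [F];
    their coefficients of degree [k] are the two sides. *)
Lemma has_kron_expansion_comp m n q (F : 'cV[R]_n -> 'cV[R]_q)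
    (G : 'cV[R]_m -> 'cV[R]_n)
    (T : forall k, 'M[R]_(q, n ^ k)) (A : forall k, 'M[R]_(n, m ^ k)) :
  has_kron_expansion F T -> has_kron_expansion G A ->
  has_kron_expansion (F \o G)
    (fun i => \sum_(1 <= j < i.+1) T j *m kron_sum A j i).
Proof.
move=> FT GA; have [sF F0 _] := FT; have [sG G0 _] := GA.
have sFG : smooth_near0 (F \o G) by exact: smooth_near0_comp.
split=> // [|k x k0]; first by rewrite /= G0.
apply/matrixP => r j0; rewrite [j0]ord1 taylor_part_coord //.
have [U [oU U0 dFG]] := smooth_near0_coord sFG.
have jet1 := has_jet_line x oU U0 (dFG k.+1 r).
have jet2 : has_jet k.+1 (fun t => F (G (t *: x)) r 0)
    (0 + \sum_(j < k.+1 | (0 < j)%N) \sum_c (T j r c)%:P *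
      \prod_(d <- kron_digits c)
        \sum_(l < k.+1 | (0 < l)%N) (A l *m kron_pow x l) d 0 *: 'X^l).
  have [UF [oUF UF0 dF]] := smooth_near0_coord sF.
  have -> : (fun t => F (G (t *: x)) r 0) = (fun t =>
      (F (G (t *: x)) r 0 - \sum_(j < k.+1 | (0 < j)%N)
         \sum_c T j r c * \prod_(d <- kron_digits c) G (t *: x) d 0)
      + \sum_(j < k.+1 | (0 < j)%N)
         \sum_c T j r c * \prod_(d <- kron_digits c) G (t *: x) d 0).
    by apply/funext => t; rewrite subrK.
  (* The remainder of [F] has approximation 0; the rest is a polynomial in the
     entries of [G (t *: x)]. *)
  apply: has_jetD; last first.
    apply: has_jet_sum => j _; apply: has_jet_sum => c _.
    apply: has_jetM; first exact: has_jet_cst.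
    by apply: has_jet_prod => d; exact: curve_jet.
  have [C C0 nearC] := taylor_column oUF UF0 (dF k.+1 r).
  have [D D0 nearD] := curve_le x GA.
  have Gx0 : G (t *: x) @[t --> 0^'+] --> (0 : 'cV[R]_n).
    apply: cvg_at_right_filter.
    have c0 : t *: x @[t --> (0 : R)] --> (0 *: x : 'cV[R]_m).
      by apply: cvgZl; exact: cvg_id.
    rewrite scale0r in c0; rewrite -G0; apply: (cvg_comp _ _ c0).
    have [UG [_ UG0] /(_ [::] 0 UG0)] := sG.
    exact: differentiable_continuous.
  exists (C * D ^+ k.+1); first by rewrite mulr_ge0 ?exprn_ge0.
  near=> t; rewrite horner0 subr0 -(taylor_poly1 _ _ _ FT).
  have t0 : 0 <= t by near: t; exact: nbhs_right_ge.
  have Gt : `|G (t *: x)| <= D * t by near: t.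
  rewrite -mulrA -exprMn.
  have /le_trans : `|F (G (t *: x)) r 0 - (taylor_poly (fun j => iter_derive
     (fun z => F z r 0) (nseq j (G (t *: x))) 0) k.+1).[1]| <=
     C * `|G (t *: x)| ^+ k.+1 by near: t; exact: (Gx0 _ nearC).
  by apply; rewrite ler_wpM2l // lerXn2r // nnegrE ?mulr_ge0.
have := has_jet_unique jet1 jet2 (ltnSn k).
rewrite coef_taylor_poly // => ->; rewrite add0r coef_sum mulmx_suml summxE.
(* Both sums become sums over [1 <= j < k.+1]. *)
rewrite -(big_mkord (fun j => 0 < j)%N (fun j => (\sum_c (T j r c)%:P *
      \prod_(d <- kron_digits c)
        \sum_(l < k.+1 | (0 < l)%N) (A l *m kron_pow x l) d 0 *: 'X^l)`_k)).
rewrite big_ltn_cond //= big_nat_cond [RHS]big_nat_cond.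
apply: eq_big => [j|j _]; first by case: j.
rewrite coef_sum -mulmxA mxE; apply: eq_bigr => c _.
by rewrite coefCM kron_sumE.
Unshelve. all: by end_near.
Qed.

End Composition.

Theorem proposition3p1 (R : realType) (n m p : nat)
  (f : 'cV[R]_n -> 'cV[R]_n) (g : 'cV[R]_n -> 'M[R]_(n, m))
  (h : 'cV[R]_n -> 'cV[R]_p)
  (Ec Eo : 'cV[R]_n -> R)
  (Phi phi : 'cV[R]_n -> 'cV[R]_n) (sigma : 'I_n -> R -> R)
  (T A : forall k : nat, 'M[R]_(n, n ^ k))
  (hlin : admissible_linearization f g h)
  (hEc : controllability_energy f g Ec)
  (hEo : observability_energy f g h Eo)
  (hPhi : input_normal_output_diagonal Ec Eo Phi sigma)
  (hphi : scaling_transformation sigma phi)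
  (hT : has_kron_expansion Phi T)
  (hA : has_kron_expansion phi A) :
  has_kron_expansion (Phi \o phi)
    (fun i => \sum_(1 <= j < i.+1) T j *m kron_sum A j i).
Proof.
exact: has_kron_expansion_comp hT hA.
Qed.
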